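(* There exist an absolute constant $C>0$ and infinitely many positive integers $n$ for which there is an order-$n$ Latin square $L$ such that every empty cube of $L$ has side at most $C (n\log n)^{1/2}$.
   Context: Write $[n]=\{1,\dots,n\}$. An order-$n$ Latin square is a map $L:[n]\times[n]\to[n]$ such that for each fixed $i$ the map $j\mapsto L(i,j)$ is a bijection and for each fixed $j$ the map $i\mapsto L(i,j)$ is a bijection. For $X,Y,Z\subseteq[n]$, the box $X\times Y\times Z$ is called an empty box of $L$ if there are no $i\in X$, $j\in Y$ with $L(i,j)\in Z$. A cube is a box $X\times Y\times Z$ with $|X|=|Y|=|Z|$; its side is this common cardinality. *)

(* Defs.v *)
From mathcomp Require Import all_boot.

Set Implicit Arguments.
Unset Strict Implicit.
Unset Printing Implicit Defensive.

(* The index set {1, ..., n} is represented by 'I_n, i.e. {0, ..., n-1}. *)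

Definition latin_square (n : nat) (L : 'I_n -> 'I_n -> 'I_n) : Prop :=
  (forall i : 'I_n, bijective (fun j : 'I_n => L i j)) /\
  (forall j : 'I_n, bijective (fun i : 'I_n => L i j)).

Definition empty_box (n : nat) (L : 'I_n -> 'I_n -> 'I_n)
    (X Y Z : {set 'I_n}) : Prop :=
  ~ exists i j : 'I_n, [/\ i \in X, j \in Y & L i j \in Z].

Definition cube_of_side (n : nat) (k : nat) (X Y Z : {set 'I_n}) : Prop :=
  [/\ #|X| = k, #|Y| = k & #|Z| = k].

(* Main.v *)
(* Let F and K be fields of orders p = 2^k and q = 4p, and partition 3p of the
   slopes of lines in the plane K^2 into three classes indexed by F. Rows,
   columns and symbols are the lines with slope in the first, second and third
   class, so n = pq. A row and a column meet in exactly one point P, and the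
   lines through P form a copy of F for each class; the entry is the line
   through P of index a u + b v + c, where (a, b, c) with a, b <> 0 is chosen
   independently and uniformly for each P.
   If X, Y and Z have 2qt lines each, then by Chebyshev's inequality at least a
   quarter of the q^2 points lie on t lines of each of them, and by the second
   moment method each such point yields an entry in the cube with probability
   at least t^3 / (2p). With t a large multiple of sqrt k, this beats the
   n^(6qt) choices of the cube. We take k = 4^i to make t a power of 2. *)
Require Import Defs.
From mathcomp Require Import all_boot all_order all_algebra all_field.
From mathcomp Require Import all_classical all_reals all_analysis.
From mathcomp Require Import zify ring lra.

Set Implicit Arguments.
Unset Strict Implicit.
Unset Printing Implicit Defensive.

Import Order.TTheory GRing.Theory Num.Theory.

Local Open Scope nat_scope.

Lemma exists_subset_card (T : finType) (A : {set T}) t :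
  t <= #|A| -> exists2 B : {set T}, B \subset A & #|B| = t.
Proof.
move=> tA; have : 0 < #|[set B : {set T} | B \subset A & #|B| == t]|.
  by rewrite cards_draws bin_gt0.
by case/card_gt0P=> B; rewrite inE => /andP[sBA /eqP cB]; exists B.
Qed.

(** * Random affine Latin squares over a finite field *)

Section AffineLatinSquares.
Variable F : finFieldType.
Local Notation p := #|F|.
Implicit Types (w : F * F * F) (A B D : {set F}).

(** Nonzero coefficients of [u] and [v] are what makes [affine_op w] a Latin square on [F]. *)
Definition affine_params := [set w : F * F * F | (w.1.1 != 0%R) && (w.1.2 != 0%R)].

Definition affine_op w (u v : F) : F := (w.1.1 * u + w.1.2 * v + w.2)%R.

Definition affine_hit A B D w :=
  [exists u in A, exists v in B, affine_op w u v \in D].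

Let through (x : F * F * F) w := affine_op w x.1.1 x.1.2 == x.2.

Lemma card_nonzero : #|[set a : F | a != 0%R]| = p.-1.
Proof.
rewrite -(cardC1 (0%R : F)); apply: eq_card => a.
by rewrite !inE.
Qed.

Lemma card_affine_params : #|affine_params| = p * p.-1 ^ 2.
Proof.
set N := [set a : F | a != 0%R].
have -> : affine_params = finset.setX (finset.setX N N) [set: F].
  by apply/finset.setP=> -[[a b] c]; rewrite !inE /= andbT.
by rewrite !cardsX cardsT card_nonzero mulnC mulnn.
Qed.

Lemma card_through x : #|[set w in affine_params | through x w]| = p.-1 ^ 2.
Proof.
set N := [set a : F | a != 0%R].
pose f (ab : F * F) := (ab, x.2 - ab.1 * x.1.1 - ab.2 * x.1.2)%R.
have -> : [set w in affine_params | through x w] = f @: finset.setX N N.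
  apply/finset.setP=> -[[a b] c]; rewrite !inE /=; apply/idP/imsetP.
    case/andP=> ab0 /eqP e; exists (a, b); first by rewrite !inE.
    by rewrite /f -e /affine_op /=; congr pair; ring.
  case=> -[a' b']; rewrite !inE /= => ab0 [-> -> ->]; rewrite ab0 /=.
  by rewrite /through /affine_op /=; apply/eqP; ring.
rewrite card_imset; last by move=> ab ab' [].
by rewrite cardsX card_nonzero mulnn.
Qed.

(** Subtracting the two equations eliminates the constant term. If [u = u'], the rest determines the
    coefficient of [v], so the coefficient of [u] fixes [w]; otherwise the roles are exchanged. *)
Lemma card_through2 x y : x != y ->
  #|[set w in affine_params | through x w && through y w]| <= p.-1.
Proof.
move=> xy; rewrite -card_nonzero.
case: x y xy => [[u v] z] [[u' v'] z'].
set S := [set w in _ | _] => xy.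
have [eu|nu] := eqVneq u u'.
  subst u'.
  have inj : {in S &, injective (fun w => w.1.1)}.
    move=> [[a b] c] [[a' b'] c']; rewrite !inE /through /affine_op /=.
    case/andP=> _ /andP[/eqP e1 /eqP e2] /andP[_ /andP[/eqP e3 /eqP e4]] ea.
    subst a'.
    have nv : (v - v' != 0)%R.
      rewrite subr_eq0; apply: contra_neq xy => ev.
      by rewrite -e1 -e2 ev.
    have eb : b = b'.
      apply: (mulIf nv).
      have -> : (b * (v - v') = z - z')%R by rewrite -e1 -e2; ring.
      by rewrite -e3 -e4; ring.
    subst b'; congr pair.
    by apply: (addrI (a * u + b * v)%R); rewrite e1 e3.
  rewrite -(card_in_imset inj); apply/subset_leq_card/fintype.subsetP=> a.
  by case/imsetP=> w; rewrite !inE => /andP[/andP[]] ? _ _ ->.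
have inj : {in S &, injective (fun w => w.1.2)}.
  move=> [[a b] c] [[a' b'] c']; rewrite !inE /through /affine_op /=.
  case/andP=> _ /andP[/eqP e1 /eqP e2] /andP[_ /andP[/eqP e3 /eqP e4]] eb.
  subst b'.
  have nu' : (u - u' != 0)%R by rewrite subr_eq0.
  have ea : a = a'.
    apply: (mulIf nu').
    have -> : (a * (u - u') = z - z' - b * (v - v'))%R by rewrite -e1 -e2; ring.
    by rewrite -e3 -e4; ring.
  subst a'; congr pair.
  by apply: (addrI (a * u + b * v)%R); rewrite e1 e3.
rewrite -(card_in_imset inj); apply/subset_leq_card/fintype.subsetP=> a.
by case/imsetP=> w; rewrite !inE => /andP[/andP[]] _ ? _ ->.
Qed.

(* Second moment method: if N of the t ^ 3 triples of A x B x D lie on the graph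
   of affine_op w, then 2 * (N > 0) >= 3 * N - N ^ 2, and through 2 distinct
   triples there pass at most p - 1 parameters w. *)
Lemma card_affine_miss t A B D :
  #|A| = t -> #|B| = t -> #|D| = t -> t ^ 3 < p ->
  2 * #|[set w in affine_params | ~~ affine_hit A B D w]| + t ^ 3 * p.-1 ^ 2
    <= 2 * #|affine_params|.
Proof.
move=> cA cB cD tp.
pose T := finset.setX (finset.setX A B) D.
have cT : #|T| = t ^ 3 by rewrite !cardsX cA cB cD; lia.
pose N w := \sum_(x in T) through x w.
have sumN : \sum_(w in affine_params) N w = t ^ 3 * p.-1 ^ 2.
  rewrite /N exchange_big /= -cT -sum_nat_const; apply: eq_bigr => x _.
  rewrite -(card_through x) -sum1dep_card big_mkcondr /=.
  by apply: eq_bigr => w _; case: (through x w).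
have sumN2 : \sum_(w in affine_params) N w ^ 2
    <= t ^ 3 * p.-1 ^ 2 + t ^ 3 * t ^ 3 * p.-1.
  have -> : \sum_(w in affine_params) N w ^ 2 = \sum_(x in T) \sum_(y in T)
      #|[set w in affine_params | through x w && through y w]|.
    transitivity (\sum_(w in affine_params) \sum_(x in T) \sum_(y in T)
        (through x w && through y w : nat)).
      apply: eq_bigr => w _; rewrite -mulnn big_distrl /=.
      apply: eq_bigr => x _; rewrite big_distrr /=; apply: eq_bigr => y _.
      by rewrite mulnb.
    rewrite exchange_big; apply: eq_bigr => x _.
    rewrite exchange_big; apply: eq_bigr => y _ /=.
    rewrite -sum1dep_card big_mkcondr /=; apply: eq_bigr => w _.
    by case: (_ && _).
  rewrite -mulnA -{1 2}cT -mulnDr -sum_nat_const; apply: leq_sum => x xT.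
  rewrite (bigD1 x) //=; apply: leq_add.
    rewrite -(card_through x); apply/subset_leq_card/fintype.subsetP=> w.
    by rewrite !inE andbb.
  rewrite -cT -sum_nat_const [leqRHS](bigD1 x) //=.
  apply: (leq_trans _ (leq_addl _ _)); apply: leq_sum => y /andP[_ yx].
  by apply: card_through2; rewrite eq_sym.
have pt w : 3 * N w + 2 * ~~ affine_hit A B D w <= N w ^ 2 + 2.
  case: (boolP (affine_hit A B D w)) => hit /=.
    by rewrite muln0 addn0; case: (N w) => [|[|m]] //; rewrite -mulnn; nia.
  rewrite /N big1 // => -[[u v] z]; rewrite !inE /= => /andP[/andP[uA vB] zD].
  case: (boolP (through _ _)) => // /eqP /= e; case/negP: hit.
  by apply/exists_inP; exists u => //; apply/exists_inP; exists v; rewrite //= e.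
have : 3 * (\sum_(w in affine_params) N w) +
    2 * (\sum_(w in affine_params) ~~ affine_hit A B D w)
    <= \sum_(w in affine_params) N w ^ 2 + #|affine_params| * 2.
  by rewrite 2!big_distrr -sum_nat_const -2!big_split; apply: leq_sum => w _; apply: pt.
rewrite sumN.
have -> : \sum_(w in affine_params) ~~ affine_hit A B D w =
    #|[set w in affine_params | ~~ affine_hit A B D w]|.
  rewrite -sum1dep_card big_mkcondr /=; apply: eq_bigr => w _.
  by case: (affine_hit _ _ _ _).
move: sumN2 (ltn_predK tp).
set S2 := \sum_(_ in _) _; set a := #|[set w in _ | _]|; set b := #|affine_params|.
move=> h1 h2 h3.
(* Since [t ^ 3 <= p - 1], the pairs of distinct triples contribute at most as much as the
   diagonal. *)
have : t ^ 3 * t ^ 3 * p.-1 <= t ^ 3 * p.-1 ^ 2.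
  by rewrite -mulnn mulnA leq_mul // leq_mul //; lia.
lia.
Qed.

Lemma affine_hit_sub A A' B B' D D' v :
  A \subset A' -> B \subset B' -> D \subset D' ->
  affine_hit A B D v -> affine_hit A' B' D' v.
Proof.
move=> /fintype.subsetP sA /fintype.subsetP sB /fintype.subsetP sD.
move=> /exists_inP[x xA /exists_inP[y yB h]].
by apply/exists_inP; exists x; auto; apply/exists_inP; exists y; auto.
Qed.

(** Larger sets are only easier to hit, so each is cut down to [t] elements. There are
    [p * (p - 1) ^ 2] parameters and [M] is [2 * p / t ^ 3], so a random one misses with probability
    at most [1 - 1 / M]. *)
Lemma card_affine_miss_ratio t M A B D : t ^ 3 < p -> M * t ^ 3 = 2 * p ->
  t <= #|A| -> t <= #|B| -> t <= #|D| ->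
  M * #|[set v in affine_params | ~~ affine_hit A B D v]|
    <= M.-1 * #|affine_params|.
Proof.
move=> tp Mt /exists_subset_card[A' sA cA] /exists_subset_card[B' sB cB].
move=> /exists_subset_card[D' sD cD].
set S := [set v in _ | _].
have leS : #|S| <= #|[set v in affine_params | ~~ affine_hit A' B' D' v]|.
  apply/subset_leq_card/fintype.subsetP=> v; rewrite !inE => /andP[-> /=].
  by apply: contra; apply: affine_hit_sub.
have := card_affine_miss cA cB cD tp.
have := card_affine_params; move: leS.
set x := #|S|; set y := #|[set v in _ | _]|; set a := #|affine_params|.
move=> xy ea h.
have : M * (2 * y) + 2 * a <= M * (2 * a).
  have e2 : 2 * a = M * (t ^ 3 * p.-1 ^ 2) by rewrite ea mulnA -Mt mulnA.
  by rewrite [X in _ + X]e2 -mulnDr leq_mul2l h orbT.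
have : M * x <= M * y by rewrite leq_mul2l xy orbT.
by case: M {Mt} => //= M; nia.
Qed.

End AffineLatinSquares.

(** * Counting inequalities and the union bound *)

Lemma leq_bin_exp n m : 'C(n, m) <= n ^ m.
Proof.
elim: n m => [|n IHn] [|m] //.
rewrite binS; apply: leq_trans (leq_add (IHn _) (IHn _)) _.
by rewrite !expnS addnC -mulSn leq_mul //; case: m => // m; rewrite leq_exp2r.
Qed.

(** With [M = x + 1], Bernoulli's inequality [(1 + 1/x) ^ m >= 1 + m/x] at [m = M] gives
    [(1 - 1/M) ^ M <= 1/2]; this is raised to the power [E]. *)
Lemma leq_exp2_ratio M E N :
  0 < M -> M * E <= N -> M.-1 ^ N * 2 ^ E <= M ^ N.
Proof.
case: M => // x _ /= leN.
have bernoulli m : x ^ m * (x + m) <= x * x.+1 ^ m.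
  elim: m => [|m IHm]; first by rewrite !expn0 addn0 muln1 mul1n.
  rewrite (expnS x.+1) mulnCA; apply: leq_trans (leq_mul (leqnn _) IHm).
  by rewrite expnS; nia.
have half : x ^ x.+1 * 2 <= x.+1 ^ x.+1.
  case: (posnP x) => [-> //|x_gt0].
  rewrite -(leq_pmul2l x_gt0); apply: leq_trans (bernoulli _).
  by rewrite mulnCA leq_mul2l; apply/orP; right; lia.
rewrite -(subnKC leN) 2!(expnD _ (x.+1 * E)) mulnAC leq_mul //; last first.
  by case: (N - _) => // d; rewrite leq_exp2r.
rewrite !expnM -expnMn.
by case: E {leN} => // E; rewrite leq_exp2r.
Qed.

Lemma union_bound (T J : finType) (S : {set T}) (I : {set J}) (bad : J -> {set T}) b :
  (forall j, j \in I -> #|bad j| <= b) -> #|I| * b < #|S| ->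
  exists2 x, x \in S & forall j, j \in I -> x \notin bad j.
Proof.
move=> le_b ltS.
have : ~~ (S \subset \bigcup_(j in I) bad j).
  apply: contraL ltS => sub; rewrite -leqNgt.
  apply: leq_trans (subset_leq_card sub) _.
  rewrite -sum_nat_const; apply: leq_trans (leq_sum _ le_b).
  elim/big_rec2: _ => [|j k A _ leA]; first by rewrite cards0.
  by rewrite (leq_trans (leq_card_setU _ _)) ?leq_add2l.
case/fintype.subsetPn=> x xS nx; exists x => // j jI.
by apply: contra nx => xj; apply/finset.bigcupP; exists j.
Qed.

Lemma card_family_prod (aT rT : finType) (G : aT -> {set rT}) :
  #|family (fun x => mem (G x))| = \prod_x #|G x|.
Proof. by rewrite card_family foldrE big_map big_enum. Qed.

(** * Point-line incidences in the plane over [K] *)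

Section LineIncidence.
Variables (F K : finFieldType) (m : F -> K).
Hypothesis m_inj : injective m.
Local Notation q := #|K|.
Implicit Types (X : {set F * K}) (P : K * K).

(* A pair (u, b) stands for the line y = m u * x + b. *)
Definition line_through (u : F) P : F * K := (u, (P.2 - m u * P.1)%R).

(** Slope indices are collected instead of lines, so that the set can be a side of a box for
    [affine_op] at [P]. *)
Definition lines_at X P := [set u | line_through u P \in X].

Let inc (l : F * K) P := line_through l.1 P == l.

Lemma card_lines_at X P : #|lines_at X P| = \sum_(l in X) inc l P.
Proof.
have -> : \sum_(l in X) inc l P = #|[set l in X | inc l P]|.
  by rewrite -sum1dep_card big_mkcondr; apply: eq_bigr => l _; case: inc.
have inj : {in lines_at X P &, injective (line_through^~ P)} by move=> u u' _ _ [].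
rewrite -(card_in_imset inj); apply: eq_card => l; rewrite inE.
apply/imsetP/andP => [[u]|[lX /eqP e]].
  by rewrite inE => uX ->; split=> //; apply/eqP.
by exists l.1; rewrite ?inE e.
Qed.

Lemma card_points_on (l : F * K) : \sum_P inc l P = q.
Proof.
have -> : \sum_P inc l P = #|[set P | inc l P]|.
  by rewrite -sum1dep_card [RHS]big_mkcond; apply: eq_bigr => P _; case: inc.
have -> : [set P | inc l P] = [set (x, m l.1 * x + l.2)%R | x : K].
  apply/finset.setP=> -[x y]; rewrite inE /inc /line_through; case: l => u b /=.
  apply/eqP/imsetP => [[<-]|[x' _ [-> ->]]].
    by exists x => //; congr pair; ring.
  by congr pair; ring.
by rewrite card_imset // => x x' [].
Qed.

Lemma card_common_points (l l' : F * K) : l != l' -> \sum_P inc l P * inc l' P <= 1.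
Proof.
move=> ll'.
have -> : \sum_P inc l P * inc l' P = #|[set P | inc l P && inc l' P]|.
  by rewrite -sum1dep_card [RHS]big_mkcond; apply: eq_bigr => P _; do 2 case: inc.
case: l l' ll' => [u b] [u' b'] ll'; apply/card_le1_eqP.
move=> [x y] [x' y']; rewrite !inE /inc /line_through /=.
case/andP=> /eqP[e1] /eqP[e2] /andP[/eqP[e3] /eqP[e4]].
have [eu|nu] := eqVneq u u'.
  by case/eqP: ll'; rewrite -e1 -e2 eu.
have nm : (m u - m u' != 0)%R by rewrite subr_eq0 (inj_eq m_inj).
have ex : x = x'.
  apply: (mulfI nm); transitivity (b' - b)%R; first by rewrite -e1 -e2; ring.
  by rewrite -e3 -e4; ring.
have ey : y = y' by apply: (addIr (- (m u * x))%R); rewrite e1 ex e3.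
by rewrite ex ey.
Qed.

Lemma sum_lines_at X : \sum_P #|lines_at X P| = #|X| * q.
Proof.
under eq_bigr do rewrite card_lines_at.
rewrite exchange_big -sum_nat_const; apply: eq_bigr => l _.
exact: card_points_on.
Qed.

(** The square counts pairs of lines of [X] through [P]. Over all [P], a line paired with itself
    counts [q] times, and two distinct lines at most once. *)
Lemma sum_lines_at_sqr X : \sum_P #|lines_at X P| ^ 2 <= #|X| * q + #|X| ^ 2.
Proof.
have -> : \sum_P #|lines_at X P| ^ 2 =
    \sum_(l in X) \sum_(l' in X) \sum_P inc l P * inc l' P.
  transitivity (\sum_P \sum_(l in X) \sum_(l' in X) inc l P * inc l' P).
    apply: eq_bigr => P _; rewrite card_lines_at -mulnn big_distrl /=.
    by apply: eq_bigr => l _; rewrite big_distrr.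
  by rewrite exchange_big; apply: eq_bigr => l _; rewrite exchange_big.
rewrite -mulnn -mulnDr -sum_nat_const; apply: leq_sum => l lX.
rewrite (bigD1 l) //=; apply: leq_add.
  rewrite -(card_points_on l); apply: leq_sum => P _.
  by case: inc.
rewrite -sum1_card [leqRHS](bigD1 l) //=.
apply: (leq_trans _ (leq_addl _ _)); apply: leq_sum => l' /andP[_ ll'].
by apply: card_common_points; rewrite eq_sym.
Qed.

(* Chebyshev's inequality: the average of #|lines_at X P| is 2 * t. *)
Lemma card_poor_points X t : #|X| = 2 * q * t -> 0 < t ->
  #|[set P | #|lines_at X P| < t]| * t <= 2 * q ^ 2.
Proof.
move=> cX t_gt0; set S := [set P | _].
have sum_const : \sum_(P : K * K) 4 * t ^ 2 = 4 * t ^ 2 * q ^ 2.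
  by rewrite sum_nat_const card_prod mulnn mulnC.
(* Termwise this is [(x - 2 * t) ^ 2 >= t ^ 2] at the points with [x < t], and [>= 0] elsewhere. *)
have : 4 * t * (\sum_P #|lines_at X P|) + t ^ 2 * #|S|
    <= \sum_P #|lines_at X P| ^ 2 + 4 * t ^ 2 * q ^ 2.
  have -> : #|S| = \sum_P (P \in S).
    by rewrite -sum1_card big_mkcond; apply: eq_bigr => P _; case: (P \in S).
  rewrite -sum_const 2!big_distrr -2!big_split.
  apply: leq_sum => P _ /=; rewrite inE; move: #|_| => x.
  case: (ltnP x t) => [xt|_] /=.
    by rewrite -(subnKC (ltnW xt)); move: (t - x) => d; nia.
  by have [+ _] := nat_Cauchy x (2 * t); nia.
move: (sum_lines_at_sqr X); rewrite sum_lines_at cX.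
set u := \sum_P _; set a := #|S| => h1 h2.
have : t * (a * t) <= t * (2 * q ^ 2) by nia.
by rewrite leq_pmul2l.
Qed.

End LineIncidence.

(** * The random Latin square on lines *)

Section RandomLatinSquare.
Variables (F K : finFieldType) (mR mC mS : F -> K).
Hypotheses (mR_inj : injective mR) (mC_inj : injective mC) (mS_inj : injective mS).
Hypotheses (mRC : forall u v, mR u != mC v) (mRS : forall u v, mR u != mS v)
  (mCS : forall u v, mC u != mS v).
Local Notation p := #|F|.
Local Notation q := #|K|.
Implicit Types (w : K * K -> F * F * F) (X Y Z : {set F * K}) (P : K * K)
  (r c : F * K).

Definition meet r c : K * K :=
  let x := ((c.2 - r.2) / (mR r.1 - mC c.1))%R in (x, mR r.1 * x + r.2)%R.

Definition cell w r c : F * K :=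
  let P := meet r c in line_through mS (affine_op (w P) r.1 c.1) P.

(** Both points lie on the same line of slope [a] and on the same line of slope [a'], and these
    lines are not parallel. *)
Lemma eq_point (a a' : K) P P' : a != a' ->
  (P.2 - a * P.1 = P'.2 - a * P'.1)%R -> (P.2 - a' * P.1 = P'.2 - a' * P'.1)%R ->
  P = P'.
Proof.
case: P P' => [x y] [x' y'] /= aa' e e'.
have na : (a' - a != 0)%R by rewrite subr_eq0 eq_sym.
have ex : x = x'.
  apply: (mulfI na); transitivity ((y - a * x) - (y - a' * x))%R; first by ring.
  by rewrite e e'; ring.
by congr pair => //; apply: (addIr (- (a * x))%R); rewrite e ex.
Qed.

Lemma meet_row r c : line_through mR r.1 (meet r c) = r.
Proof. by case: r => u b; rewrite /line_through /=; congr pair; ring. Qed.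

Lemma meet_col r c : line_through mC c.1 (meet r c) = c.
Proof.
case: r c => [u b] [v b']; rewrite /line_through /meet /=; congr pair; field.
by rewrite subr_eq0.
Qed.

Lemma meet_line u v P : meet (line_through mR u P) (line_through mC v P) = P.
Proof.
set r := line_through _ _ _; set c := line_through _ _ _.
apply: (eq_point (mRC u v)).
  exact: (congr1 snd (meet_row r c)).
exact: (congr1 snd (meet_col r c)).
Qed.

(** If two columns give the same symbol in row [r], both meeting points lie on the row and on the
    symbol, whose slopes differ, so they coincide. At this common point the nonzero coefficient of
    [v] forces equal column indices, and point and index determine the column. *)
Lemma cell_injr w r : (forall P, w P \in affine_params F) -> injective (cell w r).
Proof.
move=> wO c c' [ev e].
have er := congr1 snd (meet_row r c); have er' := congr1 snd (meet_row r c').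
have eP : meet r c = meet r c'.
  apply: (eq_point (mRS r.1 (affine_op (w (meet r c)) r.1 c.1))).
    exact: etrans er (esym er').
  by rewrite e ev.
have ec1 : c.1 = c'.1.
  have := wO (meet r c'); rewrite inE => /andP[_ b0].
  move: ev; rewrite /affine_op eP => /addIr /addrI; exact: mulfI.
by rewrite -(meet_col r c) -(meet_col r c') eP ec1.
Qed.

Lemma cell_injl w c :
  (forall P, w P \in affine_params F) -> injective (fun r => cell w r c).
Proof.
move=> wO r r' [ev e].
have er := congr1 snd (meet_col r c); have er' := congr1 snd (meet_col r' c).
have eP : meet r c = meet r' c.
  apply: (eq_point (mCS c.1 (affine_op (w (meet r c)) r.1 c.1))).
    exact: etrans er (esym er').
  by rewrite e ev.
have er1 : r.1 = r'.1.
  have := wO (meet r' c); rewrite inE => /andP[a0 _].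
  move: ev; rewrite /affine_op eP => /addIr /addIr; exact: mulfI.
by rewrite -(meet_row r c) -(meet_row r' c) eP er1.
Qed.

Let hit_at X Y Z P :=
  affine_hit (lines_at mR X P) (lines_at mC Y P) (lines_at mS Z P).

Lemma cell_hit w X Y Z P : hit_at X Y Z P (w P) ->
  exists r c, [/\ r \in X, c \in Y & cell w r c \in Z].
Proof.
case/exists_inP=> u; rewrite inE => uX /exists_inP[v].
rewrite !inE => vY hZ.
exists (line_through mR u P), (line_through mC v P); split=> //.
by rewrite /cell meet_line.
Qed.

Let rich X Y Z t := [set P | [&& t <= #|lines_at mR X P|,
  t <= #|lines_at mC Y P| & t <= #|lines_at mS Z P|]].

(** Each of the three families has at most [2 * q ^ 2 / t <= q ^ 2 / 4] poor points. *)
Lemma card_rich X Y Z t : 8 <= t ->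
  #|X| = 2 * q * t -> #|Y| = 2 * q * t -> #|Z| = 2 * q * t ->
  q ^ 2 <= 4 * #|rich X Y Z t|.
Proof.
move=> t8 cX cY cZ; have t0 : 0 < t by apply: leq_trans t8.
have := card_poor_points mR_inj cX t0.
have := card_poor_points mC_inj cY t0.
have := card_poor_points mS_inj cZ t0.
set bX := [set P | _]; set bY := [set P | _]; set bZ := [set P | _].
have : q ^ 2 <= #|rich X Y Z t| + (#|bX| + #|bY| + #|bZ|).
  have <- : #|[set: K * K]| = q ^ 2 by rewrite cardsT card_prod mulnn.
  apply: (@leq_trans #|rich X Y Z t :|: (bX :|: bY :|: bZ)|).
    apply/subset_leq_card/fintype.subsetP=> P _; rewrite !inE.
    by do 3 case: ltnP => _.
  apply: leq_trans (leq_card_setU _ _) _; rewrite leq_add2l.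
  apply: leq_trans (leq_card_setU _ _) _; rewrite leq_add2r.
  exact: leq_card_setU.
nia.
Qed.

(** A given cube has at least [q ^ 2 / 4 >= M * E] rich points. The independent choices there all
    miss it with probability at most [(1 - 1/M) ^ (M * E) <= 2 ^ -E], and there are fewer than
    [2 ^ E] cubes. *)
Lemma exists_cell_hitting t M E : 8 <= t -> t ^ 3 < p -> M * t ^ 3 = 2 * p ->
  4 * (M * E) <= q ^ 2 -> (p * q) ^ (3 * (2 * q * t)) < 2 ^ E ->
  exists2 w : {ffun K * K -> F * F * F}, forall P, w P \in affine_params F &
  forall X Y Z, #|X| = 2 * q * t -> #|Y| = 2 * q * t -> #|Z| = 2 * q * t ->
  exists r c, [/\ r \in X, c \in Y & cell w r c \in Z].
Proof.
move=> t8 tp Mt ME lt_n; set s := 2 * q * t in lt_n *.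
pose a := #|affine_params F|.
pose V := [set X : {set F * K} | #|X| == s].
pose miss (j : {set F * K} * {set F * K} * {set F * K}) P :=
  [set v in affine_params F | ~~ hit_at j.1.1 j.1.2 j.2 P v].
(* This is a product set containing every choice that avoids the cube [j], so its size is the
   product of the sizes of [miss j P]. *)
pose bad j := [set w : {ffun K * K -> F * F * F} |
  w \in family (fun P => mem (miss j P))].
pose S := [set w : {ffun K * K -> F * F * F} |
  w \in family (fun P => mem (affine_params F))].
have M_gt0 : 0 < M by case: M Mt {ME} => // Mt; lia.
have p_gt1 : 1 < p by apply: leq_trans tp; rewrite ltnS; nia.
have a_gt0 : 0 < a by rewrite /a card_affine_params muln_gt0 expn_gt0; lia.
have cS : #|S| = a ^ (q ^ 2).
  by rewrite cardsE card_family_prod prod_nat_const card_prod mulnn.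
have cbad j : j \in finset.setX (finset.setX V V) V -> #|bad j| <= a ^ (q ^ 2) %/ 2 ^ E.
  case: j => [[X Y] Z]; rewrite !inE /= => /andP[/andP[/eqP cX /eqP cY] /eqP cZ].
  rewrite leq_divRL ?expn_gt0 // cardsE card_family_prod.
  pose G := rich X Y Z t.
  (* The factors [M] and [M.-1] express the ratio [1 - 1/M] at rich points without division. *)
  have le_pt P : #|miss (X, Y, Z) P| * (if P \in G then M else 1)
      <= a * (if P \in G then M.-1 else 1).
    case: (boolP (P \in G)) => [|_].
      rewrite inE => /and3P[hX hY hZ]; rewrite mulnC [leqRHS]mulnC.
      exact: (card_affine_miss_ratio tp Mt hX hY hZ).
    by rewrite !muln1; apply/subset_leq_card/fintype.subsetP=> v; rewrite inE => /andP[].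
  have : \prod_P (#|miss (X, Y, Z) P| * (if P \in G then M else 1))
      <= \prod_P (a * (if P \in G then M.-1 else 1)) by apply: leq_prod.
  rewrite 2!big_split /= -!big_mkcond /= !prod_nat_const card_prod mulnn.
  have leN : M * E <= #|G| by have := card_rich t8 cX cY cZ; rewrite -/G; lia.
  have := leq_exp2_ratio M_gt0 leN.
  set A := M.-1 ^ _; set B := M ^ _ => h1 h2.
  have B_gt0 : 0 < B by rewrite expn_gt0 M_gt0.
  rewrite -(leq_pmul2r B_gt0) mulnAC.
  apply: leq_trans (leq_mul h2 (leqnn _)) _.
  by rewrite -mulnA leq_mul.
have cI : #|finset.setX (finset.setX V V) V| <= (p * q) ^ (3 * s).
  have cV : #|V| <= (p * q) ^ s by rewrite card_draws card_prod leq_bin_exp.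
  have -> : (p * q) ^ (3 * s) = (p * q) ^ s * (p * q) ^ s * (p * q) ^ s.
    by rewrite -!expnD; congr (_ ^ _); lia.
  by rewrite !cardsX !leq_mul.
have [|w] := union_bound cbad (S := S).
  rewrite cS; apply: leq_ltn_trans (leq_mul cI (leqnn _)) _.
  (* The rounded quotient may be 0, and then multiplying by it would not preserve the strict bound
     on the number of cubes. *)
  have [d0|d_gt0] := posnP (a ^ (q ^ 2) %/ 2 ^ E).
    by rewrite d0 muln0 expn_gt0 a_gt0.
  apply: leq_trans (leq_trunc_div _ (2 ^ E)).
  by rewrite mulnC ltn_pmul2l.
rewrite inE => /familyP wO wgood; exists w => // X Y Z cX cY cZ.
have jI : (X, Y, Z) \in finset.setX (finset.setX V V) V by rewrite !inE /= cX cY cZ eqxx.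
have : ~~ [forall P, w P \in miss (X, Y, Z) P].
  by apply: contra (wgood _ jI) => /forallP h; rewrite inE; apply/familyP.
by case/forallPn=> P; rewrite inE (wO P) /= negbK; apply: cell_hit.
Qed.

End RandomLatinSquare.

(** * Transfer to ordinals and choice of parameters *)

Lemma cube_transport (T : finType) n s (f : T -> T -> T) : #|T| = n ->
  (forall x, injective (f x)) -> (forall y, injective (f^~ y)) ->
  (forall X Y Z : {set T}, #|X| = s -> #|Y| = s -> #|Z| = s ->
    exists x y, [/\ x \in X, y \in Y & f x y \in Z]) ->
  exists L : 'I_n -> 'I_n -> 'I_n, latin_square L /\
    forall k (X Y Z : {set 'I_n}),
      cube_of_side k X Y Z -> empty_box L X Y Z -> k <= s.
Proof.
move=> <- {n} injr injl hit.
exists (fun i j => enum_rank (f (enum_val i) (enum_val j))); split.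
  split=> i; apply: injF_bij => j j' /enum_rank_inj.
    by move=> /injr /enum_val_inj.
  by move=> /injl /enum_val_inj.
(* An empty cube of side above [s] would contain an empty cube of side exactly [s]. *)
move=> k X Y Z [cX cY cZ] empty; rewrite leqNgt; apply/negP=> /ltnW sk.
have sub (A : {set 'I_#|T|}) : #|A| = k ->
    exists2 B : {set T}, #|B| = s & forall x, x \in B -> enum_rank x \in A.
  move=> cA; have : s <= #|A| by rewrite cA.
  case/exists_subset_card=> B /fintype.subsetP sB cB; exists (enum_val @: B).
    by rewrite card_imset //; exact: enum_val_inj.
  by move=> x /imsetP[b bB ->]; rewrite enum_valK sB.
have [X' cX' sX] := sub X cX; have [Y' cY' sY] := sub Y cY.
have [Z' cZ' sZ] := sub Z cZ.
have [x [y [xX yY fZ]]] := hit X' Y' Z' cX' cY' cZ'.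
apply: empty; exists (enum_rank x), (enum_rank y).
by rewrite !enum_rankK; split; auto.
Qed.

Lemma exists_injection (T U : finType) : #|T| <= #|U| ->
  exists f : T -> U, injective f.
Proof.
move=> le; exists (fun x => enum_val (widen_ord le (enum_rank x))).
by move=> x y /enum_val_inj /(congr1 val) /= /val_inj /enum_rank_inj.
Qed.

Lemma exists_finField k : 0 < k -> exists F : finFieldType, #|F| = 2 ^ k.
Proof. by move=> k0; have [F _ cF] := @pPrimePowerField 2 k isT k0; exists F. Qed.

Lemma latin_square_order_pow4 i (k := 4 ^ i) : 3 <= i ->
  exists L : 'I_(2 ^ (2 * k + 2)) -> 'I_(2 ^ (2 * k + 2)) -> 'I_(2 ^ (2 * k + 2)),
  latin_square L /\ forall j (X Y Z : {set 'I_(2 ^ (2 * k + 2))}),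
    cube_of_side j X Y Z -> empty_box L X Y Z -> j <= 2 ^ (k + i + 6).
Proof.
move=> i3.
have k_big : 3 * i + 9 < k.
  rewrite /k -(subnK i3); elim: (i - 3) => // d; rewrite addSn expnS; lia.
have [F cF] := @exists_finField k ltac:(lia).
have [K cK] := @exists_finField (k + 2) ltac:(lia).
(* Three disjoint classes of [p] slopes fit into [K] because [3 * p <= 4 * p = q]. *)
have [h h_inj] : exists h : 'I_3 * F -> K, injective h.
  by apply: exists_injection; rewrite card_prod card_ord cF cK expnD; lia.
pose m j u := h (inord j : 'I_3, u).
have m_inj j : injective (m j) by move=> u v /h_inj[].
have m_neq (j j' : 'I_3) u v : j != j' -> m j u != m j' v.
  by apply: contra => /eqP /h_inj[]; rewrite !inord_val => ->.
have m01 u v : m 0 u != m 1 v by apply: (@m_neq ord0 (@Ordinal 3 1 isT)).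
have m02 u v : m 0 u != m 2 v by apply: (@m_neq ord0 (@Ordinal 3 2 isT)).
have m12 u v : m 1 u != m 2 v by apply: (@m_neq (@Ordinal 3 1 isT) (@Ordinal 3 2 isT)).
have es : 2 * #|K| * 2 ^ (i + 3) = 2 ^ (k + i + 6).
  by rewrite cK -expnS -expnD; congr (2 ^ _); lia.
(* Here [t = 8 * 2 ^ i] is [8 * sqrt k], [M = 2 * p / t ^ 3], and [E = q ^ 2 / (4 * M)] is the
   largest value allowed. *)
have [|||||w wO hit] := exists_cell_hitting (m_inj 0) (m_inj 1) (m_inj 2) m01
  (t := 2 ^ (i + 3)) (M := 2 ^ (k - (3 * i + 8))) (E := 2 ^ (k + 3 * i + 10)).
- by rewrite -[8]/(2 ^ 3) leq_exp2l //; lia.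
- by rewrite -expnM cF ltn_exp2l //; lia.
- by rewrite cF -expnM -expnD -expnS; congr (2 ^ _); lia.
- by rewrite cK -[4]/(2 ^ 2) -!expnD -expnM leq_exp2l //; lia.
- rewrite es cF cK -expnD -expnM ltn_exp2l //.
  (* With [s = 2 ^ (k + i + 6)], the exponent [E] is [16 * k * s], while the cubes number at most
     [2 ^ ((6 * k + 6) * s)]. *)
  have -> : k + 3 * i + 10 = k + i + 6 + (2 * i + 4) by lia.
  rewrite (expnD 2 (k + i + 6)) (expnD 2 (2 * i)) (expnM 2 2 i) -[2 ^ 2]/4 -/k.
  have := expn_gt0 2 (k + i + 6); move: (2 ^ (k + i + 6)) => s; nia.
rewrite es in hit.
apply: (@cube_transport _ _ _ (cell (m 0) (m 1) (m 2) w)).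
- by rewrite card_prod cF cK -expnD; congr (2 ^ _); lia.
- by move=> r; apply: cell_injr.
- by move=> c; apply: cell_injl.
- exact: hit.
Qed.

(** * Comparison of the side with the square root of n log n *)

Lemma ln2_ge_half (R : realType) : (2^-1 <= ln 2 :> R)%R.
Proof.
have := @le_ln1Dx R (- 2^-1)%R.
have -> : (1 - 2^-1 = 2^-1 :> R)%R by field.
rewrite lnV ?posrE // lerN2; apply.
by rewrite ltrN2 invf_lt1 ?ltr1n.
Qed.

Local Open Scope classical_set_scope.
Local Open Scope ring_scope.

Theorem theorem1p6 (R : realType) :
  exists C : R, 0 < C /\
    infinite_set [set n : nat | (0 < n)%N /\
      exists L : 'I_n -> 'I_n -> 'I_n, latin_square L /\
        forall (k : nat) (X Y Z : {set 'I_n}),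
          cube_of_side k X Y Z -> empty_box L X Y Z ->
          k%:R <= C * Num.sqrt (n%:R * ln n%:R)].
Proof.
exists 32%:R; split=> // /finite_seqP[s es].
(* If [s] listed all such orders, [N] would bound them, but [N < i < k < n]. The summand 3 in [i]
   ensures [3 <= i]. *)
pose N := (\max_(x <- s) x)%N.
pose i := (N + 3)%N; pose k := (4 ^ i)%N; pose n := (2 ^ (2 * k + 2))%N.
suff : n \in s.
  move=> ns; have : (n <= N)%N by apply: (@leq_bigmax_seq _ s predT id).
  rewrite leqNgt => /negP; apply.
  have ik : (i < k)%N by apply: ltn_expl.
  have : (2 * k + 2 < n)%N by apply: ltn_expl.
  by rewrite /i in ik; lia.
have : [set` s] n.
  rewrite -es; split; first by rewrite expn_gt0.
  have [L [latin hL]] := @latin_square_order_pow4 i (leq_addl _ _).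
  exists L; split=> // j X Y Z cube empty.
  apply: (@le_trans _ _ (2 ^ (k + i + 6))%N%:R).
    by rewrite ler_nat; apply: hL cube empty.
  have -> : (2 ^ (k + i + 6))%N%:R = 32%:R * (2 ^ (k + i + 1))%N%:R :> R.
    by rewrite -natrM -[32%N]/(2 ^ 5)%N -expnD; congr (2 ^ _)%:R; lia.
  rewrite ler_pM2l // -[leLHS]gtr0_norm ?ltr0n ?expn_gt0 // -sqrtr_sqr.
  rewrite ler_wsqrtr //.
  (* After removing the factor 32, the square of the side is [n * 4 ^ i = n * k], and
     [ln n = (2 * k + 2) * ln 2] is at least [k]. *)
  have -> : (2 ^ (k + i + 1))%N%:R ^+ 2 = n%:R * (2 ^ (2 * i))%N%:R :> R.
    by rewrite -natrX -natrM -expnM -expnD; congr (2 ^ _)%:R; lia.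
  rewrite ler_wpM2l // (natrX _ 2 (2 * k + 2)) lnXn //
    -(mulr_natl (ln _)) expnM -[(2 ^ 2)%N]/4%N -/k.
  have := ln2_ge_half R.
  have : (0 : R) <= k%:R by [].
  by rewrite natrD natrM; nra.
by [].
Qed.
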